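(* Let $G$ be a non locally cyclic group. The non-cyclic graph $\Gamma_G$ has no infinite clique if and only if $G/Cyc(G)$ is finite. In this case, the clique number $\omega(\Gamma_G)$ is finite.
   Context: A group is locally cyclic if each of its finitely generated subgroups is cyclic. For a group $G$, $Cyc(G)=\{x\in G : \langle x,y\rangle \text{ is cyclic for all } y\in G\}$, which is a (normal, central) subgroup of $G$. For a non locally cyclic group $G$ (possibly infinite), the non-cyclic graph $\Gamma_G$ is the simple graph with vertex set $G\setminus Cyc(G)$ in which two distinct vertices $x,y$ are adjacent if and only if $\langle x,y\rangle$ is not cyclic. A clique is a set of pairwise adjacent vertices; the clique number $\omega(\Gamma)$ is the maximum size of a clique of $\Gamma$ (it is finite when the sizes of cliques are bounded). *)

(* Defs.v *)
From HB Require Import structures.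
From mathcomp Require Import all_boot all_classical.
Set Implicit Arguments.
Unset Strict Implicit.
Unset Printing Implicit Defensive.

Local Open Scope classical_set_scope.

Section Groups.
Variable G : groupType.
Implicit Types (H X : set G).

Definition is_subgroup H : Prop := group_closed [in H].

Definition generated X : set G := smallest is_subgroup X.

Definition cyclic H : Prop := exists g : G, H = generated [set g].

Definition finitely_generated H : Prop :=
  exists2 X : set G, finite_set X & H = generated X.

Definition left_coset H (x : G) : set G := [set (x * h)%g | h in H].

(* The underlying set of G / H. *)
Definition quotient H : set (set G) := range (left_coset H).

End Groups.

Definition locally_cyclic (G : groupType) : Prop :=
  forall H : set G, is_subgroup H -> finitely_generated H -> cyclic H.

Definition Cyc (G : groupType) : set G :=
  [set x | forall y : G, cyclic (generated [set x; y])].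
Arguments Cyc G : clear implicits.

Record simple_graph := SimpleGraph {
  vertex :> Type;
  adj : vertex -> vertex -> Prop;
  adj_sym : forall x y, adj x y -> adj y x;
  adj_irrefl : forall x, ~ adj x x }.

Definition clique (Gamma : simple_graph) (K : set Gamma) : Prop :=
  forall x y, K x -> K y -> x <> y -> adj x y.

Definition no_infinite_clique (Gamma : simple_graph) : Prop :=
  ~ exists K : set Gamma, clique K /\ infinite_set K.

(* n is the maximum size of a clique; infinite cliques are excluded as well. *)
Definition is_clique_number (Gamma : simple_graph) (n : nat) : Prop :=
  (exists K : set Gamma, clique K /\ (K #= `I_n)%card) /\
  (forall K : set Gamma, clique K -> (K #<= `I_n)%card).

Section NonCyclicGraph.
Variable G : groupType.

Definition noncyclic_adj (x y : {x : G | ~ Cyc G x}) : Prop :=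
  x <> y /\ ~ cyclic (generated [set sval x; sval y]).

Lemma noncyclic_adj_sym x y : noncyclic_adj x y -> noncyclic_adj y x.
Proof. by move=> [xy ncyc]; split; [exact/nesym | rewrite setUC]. Qed.

Lemma noncyclic_adj_irrefl x : ~ noncyclic_adj x x.
Proof. by case. Qed.

End NonCyclicGraph.

Definition noncyclic_graph (G : groupType) : simple_graph :=
  SimpleGraph (@noncyclic_adj_sym G) (@noncyclic_adj_irrefl G).

(* Main.v *)
(** If [G / Cyc G] is finite, a clique injects into it, since two elements of the
    same coset of [Cyc G] generate a cyclic group.

    Conversely, call a relation almost full when every sequence contains a
    related pair [f i], [f j] with [i < j]; by Ramsey almost full relations are
    closed under intersection.  Without infinite cliques, "[<x, y>] is cyclic" is
    almost full, hence so is commutation.  Applying this to [x], [y] and to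
    [a x], [a y] shows that every centralizer has finite index, and a product
    construction with pairs of non-commuting elements then shows that the centre
    has finite index (B. H. Neumann).  So [G] is a finite union of abelian
    subgroups [H t = C(C(t))], all containing the centre, and it suffices to
    show that the elements generating a cyclic group with every element of [H]
    have finite index in [H], for [H] abelian.  If [H] is torsion-free it is
    locally cyclic, and mixed groups have infinite cliques.  If [H] is torsion,
    call [p] bad when the [p]-torsion of [H] is not cyclic: only finitely many
    primes are bad, each of them has a finite primary component, and elements of
    order prime to all bad primes generate a cyclic group with every element. *)
Require Import Defs.
From HB Require Import structures.
From mathcomp Require Import all_boot all_algebra all_classical.
From mathcomp Require Import zify.
Set Implicit Arguments.
Unset Strict Implicit.
Unset Printing Implicit Defensive.
Import GRing.Theory.

(** * Almost full relations and Ramsey's theorem *)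

Definition almost_full (T : Type) (R : T -> T -> Prop) : Prop :=
  forall f : nat -> T, exists i j, (i < j)%N /\ R (f i) (f j).

Section AlmostFull.

(** Dependent choice: the list of all terms chosen so far is fed to the hypothesis to obtain the
    next one. *)
Lemma greedy_sequence (T : eqType) (R : T -> T -> Prop) :
  (forall s : seq T, exists x, forall y, y \in s -> R y x) ->
  exists f : nat -> T, forall i j, i < j -> R (f i) (f j).
Proof.
move=> /choice[F RF].
pose l := fix l n := if n is m.+1 then F (l m) :: l m else [::].
exists (F \o l) => i j ij; apply: RF.
elim: j ij => // j IH; rewrite ltnS leq_eqVlt => /predU1P[->|/IH lj] /=.
  exact: mem_head.
by rewrite inE lj orbT.
Qed.

(** If no finite list worked, the greedy construction would yield a sequence without a related pair.
    When the relation says that [x^-1 * y] lies in a subgroup, the list represents all its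
    cosets. *)
Lemma almost_full_cover (T : eqType) (R : T -> T -> Prop) :
  almost_full R -> exists s : seq T, forall x, exists2 y, y \in s & R y x.
Proof.
move=> afR; apply: contrapT => noS.
have [|f fP] := @greedy_sequence T (fun y x => ~ R y x).
  move=> s; apply: contrapT => nox; apply: noS; exists s => x.
  apply: contrapT => noy; apply: nox; exists x => y ys Ryx; apply: noy.
  by exists y.
by have [i [j [/fP ]]] := afR f.
Qed.

Lemma almost_full_sub (T : Type) (R S : T -> T -> Prop) :
  (forall x y, R x y -> S x y) -> almost_full R -> almost_full S.
Proof. by move=> RS afR f; have [i [j [? /RS ?]]] := afR f; exists i, j. Qed.

(** It suffices to find an infinite set [S] of indices, each related to almost all later members of
    [S]; a greedy choice inside [S] then gives the subsequence. *)
Lemma almost_full_ramsey (T : Type) (R : T -> T -> Prop) (f : nat -> T) :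
  almost_full R ->
  exists2 g : nat -> nat, {homo g : i j / i < j} &
    forall i j, i < j -> R (f (g i)) (f (g j)).
Proof.
move=> afR.
pose unbounded (S : nat -> Prop) := forall n, exists2 m, n < m & S m.
pose bad (S : nat -> Prop) x y := [/\ S y, x < y & ~ R (f x) (f y)].
have [S uS badS] : exists2 S, unbounded S &
    forall x, S x -> ~ unbounded (bad S x).
  apply: contrapT => noS.
  have : forall S, exists x, unbounded S -> S x /\ unbounded (bad S x).
    move=> S; have [uS|] := pselect (unbounded S); last by exists 0.
    apply: contrapT => nox; apply: noS; exists S => // x Sx ux.
    by apply: nox; exists x.
  move=> /choice[pick pickP].
  (* Without such an [S] there are nested infinite sets, each keeping only the later indices
     unrelated to the element picked from the previous one. The picked elements then contradict that
     [R] is almost full. *)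
  pose S_ := fix S_ n := if n is m.+1 then bad (S_ m) (pick (S_ m))
                         else fun=> True.
  have uS n : unbounded (S_ n).
    elim: n => [|n /pickP[]//] m; by exists m.+1.
  have SS i j y : i <= j -> S_ j y -> S_ i y.
    by elim: j => [|j IH]; rewrite leq_eqVlt => /predU1P[->//|] // /IH h [/h].
  have [i [j [ij]]] := afR (fun n => f (pick (S_ n))).
  by have [/(SS _ _ _ ij)[]] := pickP _ (uS j).
have [|g gP] :=
    @greedy_sequence nat (fun y x => S x /\ (S y -> y < x /\ R (f y) (f x))).
  move=> s.
  have [n nP] : exists n, forall y, y \in s -> S y ->
      y < n /\ forall z, n < z -> S z -> R (f y) (f z).
    elim: s => [|y s [n IH]]; first by exists 0.
    have [Sy|nSy] := pselect (S y); last first.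
      by exists n => z; rewrite inE => /predU1P[->/nSy//|/IH].
    have /existsNP[m mP] := badS y Sy.
    exists (maxn n (maxn m y.+1)) => z; rewrite inE => /predU1P[-> _|zs Sz].
      split=> [|z']; first by lia.
      rewrite !gtn_max => /and3P[_ mz yz] Sz'.
      by apply: contrapT => nR; apply: mP; exists z'; last split=> //; lia.
    have [zn nz] := IH z zs Sz; split=> [|z']; first by lia.
    by rewrite !gtn_max => /andP[/nz].
  have [x nx Sx] := uS n.
  by exists x => y ys; split=> // /(nP y ys)[yn /(_ _ nx Sx)]; split=> //; lia.
(* The term of index 0 has no predecessor and may lie outside [S], hence the shift by one. *)
have gS i : S (g i.+1) by have [] := gP 0 i.+1 isT.
exists (fun i => g i.+1) => i j ij.
  by have [_ /(_ (gS i))[]] := gP i.+1 j.+1 ij.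
by have [_ /(_ (gS i))[]] := gP i.+1 j.+1 ij.
Qed.

Lemma almost_fullI (T : Type) (R S : T -> T -> Prop) :
  almost_full R -> almost_full S -> almost_full (fun x y => R x y /\ S x y).
Proof.
move=> afR afS f; have [g gm Rg] := almost_full_ramsey f afR.
have [i [j [ij Sij]]] := afS (f \o g).
by exists (g i), (g j); split; [exact: gm | split=> //; exact: Rg].
Qed.

Lemma almost_full_all (T : Type) (I : eqType) (s : seq I)
    (R : I -> T -> T -> Prop) :
  (forall i, i \in s -> almost_full (R i)) ->
  almost_full (fun x y => forall i, i \in s -> R i x y).
Proof.
elim: s => [|i s IH] afR; first by move=> f; exists 0, 1.
have /almost_full_sub : almost_full
    (fun x y => R i x y /\ forall j, j \in s -> R j x y).
  apply: almost_fullI; first by apply: afR; rewrite mem_head.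
  by apply: IH => j js; apply: afR; rewrite inE js orbT.
by apply=> x y [Ri Rs] j; rewrite inE => /predU1P[->|/Rs].
Qed.

End AlmostFull.

(** * Abelian groups *)

Section Zmodule.
Local Open Scope ring_scope.
Variable V : zmodType.
Implicit Types (x y a b c g h t u w : V) (p m n : nat).

(** * Multiples, cyclic pairs and coprime orders *)

Definition multiple y x : Prop := exists i : int, x = y *~ i.

(** The common [w] need not lie in [<x, y>]: subgroups of cyclic groups are cyclic. *)
Definition cyclic_pair x y : Prop := exists2 w, multiple w x & multiple w y.

Lemma multiple_mulrz y (i : int) : multiple y (y *~ i).
Proof. by exists i. Qed.

Lemma multiple_refl y : multiple y y.
Proof. by exists 1. Qed.

Lemma multiple0 y : multiple y 0.
Proof. by exists 0. Qed.

Lemma multiple_trans y x z : multiple x y -> multiple y z -> multiple x z.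
Proof. by move=> [i ->] [j ->]; rewrite -mulrzA; exists (i * j). Qed.

Lemma multipleD y x z : multiple y x -> multiple y z -> multiple y (x + z).
Proof. by move=> [i ->] [j ->]; exists (i + j); rewrite mulrzDr. Qed.

Lemma multipleN y x : multiple y x -> multiple y (- x).
Proof. by move=> [i ->]; exists (- i); rewrite mulrNz. Qed.

Lemma multipleB y x z : multiple y x -> multiple y z -> multiple y (x - z).
Proof. by move=> yx /multipleN; apply: multipleD. Qed.

Lemma multiple_mul y x (i : int) : multiple y x -> multiple y (x *~ i).
Proof. by move=> yx; apply: multiple_trans yx _; exists i. Qed.

Lemma cyclic_pairC x y : cyclic_pair x y -> cyclic_pair y x.
Proof. by move=> [w]; exists w. Qed.

Lemma cyclic_pair_multiple x y x' y' :
  multiple x x' -> multiple y y' -> cyclic_pair x y -> cyclic_pair x' y'.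
Proof.
by move=> xx' yy' [w wx wy]; exists w;
  [exact: multiple_trans xx' | exact: multiple_trans yy'].
Qed.

Lemma multiple_cyclic x y : multiple x y -> cyclic_pair x y.
Proof. by exists x => //; exact: multiple_refl. Qed.

Lemma coprime_bezout m n : coprime m n ->
  exists u v : int, u * m%:Z + v * n%:Z = 1.
Proof.
move=> mn; have /coprimezP[[u v] /= uv] : coprimez m n by rewrite coprimezE.
by exists u, v.
Qed.

Lemma coprime_split x m n : coprime m n -> x *+ (m * n) = 0 ->
  exists g h,
    [/\ x = g + h, g *+ m = 0, h *+ n = 0, multiple x g & multiple x h].
Proof.
move=> /coprime_bezout[u [v uv]] x0.
exists (x *~ (v * n)), (x *~ (u * m)).
split; try exact: multiple_mulrz.
- by rewrite -mulrzDr addrC uv.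
- rewrite !pmulrn -!mulrzA -mulrA -PoszM mulnC mulrC mulrzA.
  by rewrite -[x *~ _]pmulrn x0 mul0rz.
- rewrite !pmulrn -!mulrzA -mulrA -PoszM mulrC mulrzA.
  by rewrite -[x *~ _]pmulrn x0 mul0rz.
Qed.

Lemma multiple_coprime_add g h m n : coprime m n ->
  g *+ m = 0 -> h *+ n = 0 -> multiple (g + h) g.
Proof.
move=> /coprime_bezout[u [v uv]] g0 h0.
exists (v * n); rewrite mulrzDl mulrC [h *~ _]mulrzA -[h *~ _]pmulrn h0 mul0rz.
have -> : n%:Z * v = 1 - m%:Z * u by rewrite -uv; lia.
by rewrite mulrzBr mulrzA -[g *~ m]pmulrn g0 mul0rz subr0 addr0.
Qed.

Lemma coprime_kill x m (i : int) : x *+ m = 0 -> coprimez m i ->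
  x *~ i = 0 -> x = 0.
Proof.
move=> x0 /coprimezP[[u v] /= uv] xi.
rewrite -[x]mulr1z -uv mulrzDr [u * _]mulrC [v * _]mulrC !mulrzA.
by rewrite -[x *~ m]pmulrn x0 xi !mul0rz addr0.
Qed.

Lemma coprime_multiple x m (i : int) : x *+ m = 0 -> coprimez m i ->
  multiple (x *~ i) x.
Proof.
move=> x0 /coprimezP[[u v] /= uv]; exists v.
rewrite -[LHS]mulr1z -uv mulrzDr [u * _]mulrC [v * _]mulrC !mulrzA.
by rewrite -[x *~ m]pmulrn x0 mul0rz add0r.
Qed.

(** * Elements of prime power order *)

Definition p_elt p x : Prop := exists k, x *+ (p ^ k) = 0.

Lemma p_elt_multiple p x y : multiple x y -> p_elt p x -> p_elt p y.
Proof.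
move=> [i ->] [k xk]; exists k; rewrite pmulrn -mulrzA mulrC mulrzA.
by rewrite -[x *~ _]pmulrn xk mul0rz.
Qed.

Lemma p_elt_coprime p k (i : int) : prime p -> ~~ (p %| i)%Z ->
  coprimez (p ^ k)%N i.
Proof.
move=> pp; rewrite coprimezE dvdzE /= => pi.
by case: k => [|k]; rewrite ?coprime1n ?coprime_pexpl ?prime_coprime.
Qed.

Lemma p_elt_kill p x (i : int) : prime p -> p_elt p x -> ~~ (p %| i)%Z ->
  x *~ i = 0 -> x = 0.
Proof. by move=> pp [k xk] /(p_elt_coprime k pp); apply: coprime_kill. Qed.

Lemma p_elt_gen p x (i : int) : prime p -> p_elt p x -> ~~ (p %| i)%Z ->
  multiple (x *~ i) x.
Proof. by move=> pp [k xk] /(p_elt_coprime k pp); apply: coprime_multiple. Qed.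

Lemma p_eltD p x y : p_elt p x -> p_elt p y -> p_elt p (x + y).
Proof.
move=> [k xk] [l yl]; exists (k + l)%N.
by rewrite mulrnDl expnD {2}mulnC !mulrnA xk yl !mul0rn addr0.
Qed.

Lemma coprime_div_gcdz (i j : int) : i != 0 ->
  exists g i' j' : int, [/\ i = i' * g, j = j' * g & coprimez i' j'].
Proof.
move=> i0; have g0 : gcdz i j != 0 by rewrite gcdz_eq0 negb_and i0.
exists (gcdz i j), (i %/ gcdz i j)%Z, (j %/ gcdz i j)%Z.
rewrite !divzK ?dvdz_gcdl ?dvdz_gcdr //; split=> //; apply/coprimezP.
have [u [v uv]] := Bezoutz i j; exists (u, v) => /=; apply: (mulIf g0).
by rewrite mulrDl -!mulrA !divzK ?dvdz_gcdl ?dvdz_gcdr // mul1r.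
Qed.

(** The [p]-elements of a cyclic group form a chain: dividing the coefficients by their gcd gives
    [y *~ i' = x *~ j'] with [i'] and [j'] coprime, so [p] misses one of them, and multiplication by
    that one can be undone on [p]-elements. *)
Lemma p_elt_cyclic p x y : prime p -> p_elt p x -> p_elt p y ->
  cyclic_pair x y -> multiple x y \/ multiple y x.
Proof.
move=> pp px py [w [i xi] [j yj]].
have [i0|i0] := eqVneq i 0.
  by right; rewrite xi i0 mulr0z; exact: multiple0.
have [g [i' [j' [ig jg cij]]]] := coprime_div_gcdz j i0.
have yx : y *~ i' = x *~ j'.
  by rewrite yj xi ig jg -!mulrzA; congr (_ *~ _); lia.
have [pi|pi] := boolP (p %| i')%Z; last first.
  left; apply: multiple_trans (p_elt_gen pp py pi).
  by rewrite yx; exact: multiple_mulrz.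
right; have pj : ~~ (p %| j')%Z.
  apply/negP => pj; have := dvdz_gcd p i' j'.
  rewrite pi pj (eqP cij) dvdzE /= dvdn1 => /eqP p1.
  by rewrite p1 in pp.
apply: multiple_trans (p_elt_gen pp px pj).
by rewrite -yx; exact: multiple_mulrz.
Qed.

Lemma torsion_order x m : (0 < m)%N -> x *+ m = 0 ->
  exists2 n, (0 < n)%N & forall k, (x *+ k == 0) = (n %| k)%N.
Proof.
move=> m0 xm; have [|n /andP[n0 /eqP xn] nmin] :=
  @ex_minnP (fun n => (0 < n)%N && (x *+ n == 0)).
  by exists m; rewrite m0 xm eqxx.
exists n => // k; apply/eqP/idP => [xk|/dvdnP[q ->]]; last first.
  by rewrite mulnC mulrnA xn mul0rn.
apply: contraT => nk; suff /nmin : (0 < k %% n)%N && (x *+ (k %% n) == 0).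
  by rewrite leqNgt ltn_mod n0.
rewrite lt0n nk /=; move: xk; rewrite {1}(divn_eq k n) mulrnDr mulnC mulrnA.
by rewrite xn mul0rn add0r => ->.
Qed.

Lemma exists_prime_order x m : x != 0 -> (0 < m)%N -> x *+ m = 0 ->
  exists p t, [/\ prime p, t != 0, t *+ p = 0 & multiple x t].
Proof.
move=> x0 m0 xm; have [n n0 xn] := torsion_order m0 xm.
have n1 : (1 < n)%N.
  rewrite ltn_neqAle n0 andbT; apply: contraNneq x0 => n1.
  by rewrite -[x]mulr1n xn -n1.
have dn : (n %/ pdiv n * pdiv n)%N = n by rewrite divnK ?pdiv_dvd.
exists (pdiv n), (x *+ (n %/ pdiv n)); split.
- exact: pdiv_prime.
- have q0 : (0 < n %/ pdiv n)%N by rewrite divn_gt0 ?pdiv_gt0 ?pdiv_leq.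
  rewrite xn; apply/negP => /(dvdn_leq q0); apply/negP; rewrite -ltnNge.
  by apply: ltn_Pdiv => //; exact/prime_gt1/pdiv_prime.
- by apply/eqP; rewrite -mulrnA dn xn.
- by exists (n %/ pdiv n)%:Z.
Qed.

Lemma mulrz_absz_eq0 x (z : int) : x *~ z = 0 -> x *+ absz z = 0.
Proof.
case: z => n //=; rewrite NegzE mulrNz => /eqP.
by rewrite oppr_eq0 => /eqP.
Qed.

(** * Torsion and torsion-free groups *)

Definition torsion : Prop := forall x, exists2 n, (0 < n)%N & x *+ n = 0.

Definition torsion_free : Prop :=
  forall x n, (0 < n)%N -> x *+ n = 0 -> x = 0.

Lemma torsion_free_mulrz x (z : int) :
  torsion_free -> z != 0 -> x *~ z = 0 -> x = 0.
Proof.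
by move=> tf z0 /mulrz_absz_eq0; apply: tf; rewrite absz_gt0.
Qed.

(* If x has infinite order and t has order p, the elements p^i x + t pairwise
   generate non-cyclic subgroups. *)
Lemma torsion_dichotomy :
  almost_full cyclic_pair -> torsion \/ torsion_free.
Proof.
move=> afc; have [|/existsNP[x xinf]] := pselect torsion; first by left.
right=> t' n n0 t'n; apply/eqP; apply: contraT => t'0.
have [p [t [pp t0 tp _]]] := exists_prime_order t'0 n0 t'n.
have [i [j [ij [w wi wj]]]] := afc (fun i => x *+ (p ^ i) + t).
have tpi k : (0 < k)%N -> t *+ (p ^ k) = 0.
  by case: k => // k _; rewrite expnS mulrnA tp mul0rn.
have [k tk] : multiple w t.
  have -> : t = x *+ (p ^ j) + t - (x *+ (p ^ i) + t) *~ (p ^ (j - i))%:Z.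
    rewrite -pmulrn mulrnDl tpi ?subn_gt0 // -mulrnA -expnD subnKC 1?ltnW //.
    by rewrite addr0 addrAC subrr add0r.
  by apply: multipleB => //; exact: multiple_mul.
have [l xl] := wi.
have k0 : k != 0 by apply: contraNneq t0 => k0; rewrite tk k0 mulr0z.
have wkp : w *~ (k * p) = 0 by rewrite mulrzA -tk -pmulrn.
have : x *~ ((p ^ i)%:Z * (k * p)) = 0.
  have -> : x *~ ((p ^ i)%:Z * (k * p)) =
      (x *+ (p ^ i) + t) *~ (k * p) - t *~ (p%:Z * k).
    by rewrite [p%:Z * k]mulrC mulrzDl addrK mulrzA.
  rewrite xl -mulrzA [l * _]mulrC (mulrzA w (k * p)) wkp mul0rz.
  by rewrite [t *~ _]mulrzA -pmulrn tp mul0rz subrr.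
move=> /mulrz_absz_eq0 xk; case: xinf.
exists (absz ((p ^ i)%:Z * (k * p))) => //.
rewrite absz_gt0 !mulf_neq0 //; last by rewrite -lt0n prime_gt0.
by rewrite -lt0n expn_gt0 prime_gt0.
Qed.

(* Without torsion, x and y generate a cyclic subgroup as soon as x + i y and
   x + j y do for some i < j. *)
Lemma torsion_free_cyclic x y :
  almost_full cyclic_pair -> torsion_free -> cyclic_pair x y.
Proof.
move=> afc tf; have [->|y0] := eqVneq y 0.
  by apply: multiple_cyclic; exact: multiple0.
have [i [j [ij [w wi wj]]]] := afc (fun i => x + y *~ i).
have [n n0 [k yk]] : exists2 n : int, n != 0 & multiple w (y *~ n).
  exists (j%:Z - i%:Z); first by lia.
  rewrite mulrzBr.
  have -> : y *~ j - y *~ i = (x + y *~ j) - (x + y *~ i).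
    by rewrite opprD addrACA subrr add0r.
  exact: multipleB.
have [l xl] : multiple w (x *~ n).
  have -> : x *~ n = (x + y *~ i) *~ n - (y *~ n) *~ i.
    by rewrite mulrzDl -!mulrzA [i%:Z * n]mulrC addrK.
  by apply: multipleB; apply: multiple_mul => //; exists k.
have k0 : k != 0.
  apply: contraNneq y0 => k0; apply/eqP; apply: torsion_free_mulrz n0 _ => //.
  by rewrite yk k0 mulr0z.
have [g [k' [l' [kg lg /coprimezP[[u v] /= uv]]]]] := coprime_div_gcdz l k0.
have ylxk : y *~ l' = x *~ k'.
  apply/eqP; rewrite -subr_eq0; apply/eqP.
  apply: (@torsion_free_mulrz _ (n * g)) => //.
    by rewrite mulf_neq0 //; apply: contraNneq k0 => g0; rewrite kg g0 mulr0.
  rewrite mulrzBl -!mulrzA [l' * _]mulrC [k' * _]mulrC -!mulrA.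
  rewrite ![g * _]mulrC -kg -lg !mulrzA yk xl -!mulrzA [k * l]mulrC.
  by rewrite subrr.
exists (y *~ u + x *~ v); [exists l'|exists k'].
  rewrite mulrzDl -mulrzA [u * _]mulrC mulrzA ylxk -!mulrzA -mulrzDr.
  by rewrite [k' * _]mulrC uv mulr1z.
rewrite mulrzDl -!mulrzA [v * _]mulrC (mulrzA x) -ylxk -!mulrzA -mulrzDr.
by rewrite [l' * _]mulrC uv mulr1z.
Qed.

(** For [p] prime: the elements killed by [p] form a group of order 1 or [p]. *)
Definition p_cyclic p : Prop :=
  forall a b, a *+ p = 0 -> b *+ p = 0 -> cyclic_pair a b.

(** Induction on the exponent killing [x], through [x *+ p]. When [x *+ p = y *~ r] with
    [r = r' * p], the element [x - y *~ r'] is killed by [p]; such elements are multiples of the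
    nonzero [y], because [<y>] already contains an element of order [p]. *)
Lemma p_cyclic_multiple p x y : prime p -> p_cyclic p ->
  p_elt p x -> p_elt p y -> multiple x y \/ multiple y x.
Proof.
move=> pp pc [k xk] py; have [->|y0] := eqVneq y 0.
  by left; exact: multiple0.
elim: k x xk => [|k IH] x xk.
  by right; move: xk; rewrite expn0 mulr1n => ->; exact: multiple0.
have px : p_elt p x by exists k.+1.
have [||[r xr]] := IH (x *+ p); first by rewrite -mulrnA -expnS.
  by move=> xpy; left; apply: multiple_trans xpy; exists p%:Z.
have [/dvdzP[r' rr']|pr] := boolP (p %| r)%Z; last first.
  left; apply: multiple_trans (p_elt_gen pp py pr).
  by rewrite -xr; exists p%:Z.
pose a := x - y *~ r'; have ap : a *+ p = 0.
  by rewrite mulrnBl xr rr' mulrzA -pmulrn subrr.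
have [l yl] := py.
have [|q [b [pq b0 bq yb]]] := @exists_prime_order y (p ^ l) y0 _ yl.
  by rewrite expn_gt0 prime_gt0.
have pb : p_elt p b by apply: p_elt_multiple yb py.
have qp : q = p.
  apply/eqP; apply: contraNT b0 => qp; apply/eqP.
  apply: (@p_elt_kill p _ q%:Z) => //.
  by rewrite dvdzE /= dvdn_prime2 // eq_sym.
rewrite qp in bq.
right; have -> : x = a + y *~ r' by rewrite subrK.
apply: multipleD; last exact: multiple_mulrz.
apply: multiple_trans yb _.
have pa : p_elt p a by exists 1%N; rewrite expn1.
have [[s bs]|//] := p_elt_cyclic pp pa pb (pc _ _ ap bq).
rewrite bs; apply: (p_elt_gen pp pa).
apply: contraNN b0 => /dvdzP[s' ss'].
by rewrite bs ss' mulrC mulrzA -pmulrn ap mul0rz.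
Qed.

Lemma p_elt_add p m u h : prime p -> p_elt p u -> h *+ m = 0 -> ~~ (p %| m)%N ->
  multiple (u + h) u /\ multiple (u + h) h.
Proof.
move=> pp [k uk] hm pm.
have cpm : coprime (p ^ k) m.
  by case: k {uk} => [|k]; rewrite ?coprime1n ?coprime_pexpl ?prime_coprime.
split; first exact: multiple_coprime_add cpm uk hm.
by rewrite addrC; apply: multiple_coprime_add hm uk; rewrite coprime_sym.
Qed.

Lemma p_part_split p x n : prime p -> (0 < n)%N -> x *+ n = 0 ->
  exists g h, [/\ x = g + h, p_elt p g, multiple x g, multiple x h &
    h *+ n`_p^' = 0].
Proof.
move=> pp n0; rewrite -{1}(partnC p n0) => xn.
have [g [h [xgh gp hp xg xh]]] := coprime_split (coprime_partC p n n) xn.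
by exists g, h; split=> //; exists (logn p n); rewrite -p_part.
Qed.

Lemma p_part_coprime p n : prime p -> ~~ (p %| n`_p^')%N.
Proof.
move=> pp; rewrite -prime_coprime // (@pnat_coprime p) ?pnat_id //.
exact: part_pnat.
Qed.

Definition cyc_center x : Prop := forall y, cyclic_pair x y.

Lemma cyc_centerD x y : cyc_center x -> cyc_center y -> cyc_center (x + y).
Proof.
move=> cx cy z; have [w wy wz] := cy z; have [w' wx' ww'] := cx w.
exists w'; last exact: multiple_trans wz.
by apply: multipleD => //; apply: multiple_trans wy.
Qed.

(** Split [y] into a [p]-element [g] and an element [h] of order prime to [p]. One of [c] and [g] is
    a multiple of the other; the generating one plus [h] then generates both [c] and [y]. *)
Lemma p_elt_cyc_center p c : prime p -> p_cyclic p -> torsion -> p_elt p c ->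
  cyc_center c.
Proof.
move=> pp pc tor pec y; have [n n0 yn] := tor y.
have [g [h [-> pg _ _ hn]]] := p_part_split pp n0 yn.
have pn := p_part_coprime n pp.
have [cg|gc] := p_cyclic_multiple pp pc pec pg.
  have [ch1 ch2] := p_elt_add pp pec hn pn.
  by exists (c + h) => //; apply: multipleD => //; apply: multiple_trans cg.
exists (g + h); last exact: multiple_refl.
by apply: multiple_trans gc; have [] := p_elt_add pp pg hn pn.
Qed.

(** Induction on [n], splitting off the primary part for its least prime divisor. *)
Lemma coprime_cyc_center n c : torsion ->
  (forall p, prime p -> (p %| n)%N -> p_cyclic p) -> (0 < n)%N -> c *+ n = 0 ->
  cyc_center c.
Proof.
move=> tor; have [m] := ubnP n; elim: m n c => // m IH n c nm pc n0 cn.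
have [n1|n1] := eqVneq n 1%N.
  move: cn; rewrite n1 mulr1n => -> y; apply: cyclic_pairC.
  by apply: multiple_cyclic; exact: multiple0.
have pp : prime (pdiv n) by apply: pdiv_prime; lia.
have pn := pdiv_dvd n.
have [g [h [-> pg _ _ hn]]] := p_part_split pp n0 cn.
apply: cyc_centerD; first exact: p_elt_cyc_center (pc _ pp pn) tor pg.
apply: (IH (n`_(pdiv n)^')%N h _ _ _ hn) => //.
- rewrite ltnS in nm; apply: leq_trans nm.
  rewrite ltn_neqAle dvdn_leq ?dvdn_part // andbT.
  by apply: contraNneq (p_part_coprime n pp) => ->.
- by move=> q pq qn; apply: pc => //; apply: dvdn_trans qn (dvdn_part _ _).
Qed.

(** * Primes whose torsion is not cyclic *)

Lemma almost_full_finite (T : finType) : almost_full (@eq T).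
Proof.
move=> f; apply: contrapT => nf.
have /leq_card : injective (fun i : 'I_#|T|.+1 => f i).
  move=> i j fij; apply/val_inj; case: (ltngtP i j) => // ij; case: nf.
    by exists i, j.
  by exists j, i.
by rewrite card_ord ltnn.
Qed.

(** The translated elements are still comparable, while multiplication by [p] erases [a]. As [p]
    divides [r] and [y *+ p] is nonzero, the only surviving case is [a + x = (a + y) *~ s] with [p]
    dividing [s]; then [a *~ s = 0], so [a = y *~ (s - r)]. *)
Lemma shifted_socle_multiple p x y r a : prime p -> p_elt p x -> p_elt p y ->
  x = y *~ r -> (p %| r)%Z -> a *+ p = 0 -> x *+ p != 0 ->
  cyclic_pair (a + x) (a + y) -> multiple y a.
Proof.
move=> pp px py xr pr ap xp0; have pa : p_elt p a by exists 1%N; rewrite expn1.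
have yp0 : y *+ p != 0.
  apply: contraNneq xp0 => yp.
  by rewrite xr pmulrn -mulrzA mulrC mulrzA -pmulrn yp mul0rz.
have pyp : p_elt p (y *+ p) by apply: p_elt_multiple py; exists p%:Z.
have mz z (i : int) : (z *~ i) *+ p = (z *+ p) *~ i.
  by rewrite !pmulrn -!mulrzA mulrC.
have aD z : (a + z) *+ p = z *+ p by rewrite mulrnDl ap add0r.
have xpr : x *+ p = (y *+ p) *~ r by rewrite -mz -xr.
move=> /(p_elt_cyclic pp (p_eltD pa px) (p_eltD pa py))[[s]|[s]] axy.
  suff yp : y *+ p = 0 by rewrite yp eqxx in yp0.
  apply: (@p_elt_kill p _ (1 - r * s)) => //.
    apply/negP => prs; have := rpredD prs (dvdz_mulr s pr).
    by rewrite subrK dvdz1 absz_nat => /eqP p1; rewrite p1 in pp.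
  by rewrite mulrzBr mulr1z mulrzA -xpr -(aD x) -mz -axy aD subrr.
have [/dvdzP[s' ss']|ps] := boolP (p %| s)%Z.
  exists (s - r); rewrite mulrzBr -xr; apply/eqP; rewrite eq_sym subr_eq axy.
  rewrite mulrzDl ss' [s' * _]mulrC [a *~ _]mulrzA -pmulrn ap mul0rz.
  by rewrite add0r.
suff yp : y *+ p = 0 by rewrite yp eqxx in yp0.
apply: (@p_elt_kill p _ (s - r)) => //.
  by apply: contraNN ps => psr; rewrite -(subrK r s) rpredD.
by rewrite mulrzBr -xpr -(aD y) -mz -axy aD subrr.
Qed.

(* Along an infinite chain of p-elements g_k that stays pairwise cyclic after
   translation by a and by b, both a and b lie in some <g_k>. *)
Lemma almost_full_p_elt p : almost_full cyclic_pair -> prime p ->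
  ~ p_cyclic p -> forall f : nat -> V, (forall i, p_elt p (f i)) ->
  exists i j, (i < j)%N /\ f i = f j.
Proof.
move=> afc pp /existsNP[a /existsNP[b]] /not_implyP[ap] /not_implyP[bp nab].
move=> f pf; apply: contrapT => finj.
have af_translate c :
    almost_full (fun x y => cyclic_pair (c + x) (c + y)).
  by move=> f'; have := afc (fun i => c + f' i).
have [g gm Qg] := almost_full_ramsey f
  (almost_fullI afc (almost_fullI (af_translate a) (af_translate b))).
pose e i := f (g i).
have pe i : p_elt p (e i) by exact: pf.
have eN i j : (i < j)%N -> e i <> e j.
  by move=> /gm ij eij; apply: finj; exists (g i), (g j).
(* The multiples of [e i] are finite in number and the terms are distinct, so some later [e j] is
   not a multiple of [e i]. Comparability makes [e i] a multiple of [e j], and [p] divides the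
   coefficient, which otherwise could be undone. *)
have climb i : exists2 j, (i < j)%N & exists2 r, (p %| r)%Z & e i = e j *~ r.
  have [k eik] := pe i.
  have [j ij nej] : exists2 j, (i < j)%N & ~ multiple (e i) (e j).
    apply: contrapT => nj.
    have /choice[r rP] : forall j, exists r : 'I_(p ^ k).-1.+1,
        (i < j)%N -> e j = e i *+ r.
      move=> j; have [ij|ij] := ltnP i j; last by exists ord0.
      have [s es] : multiple (e i) (e j).
        by apply: contrapT => nm; apply: nj; exists j.
      have pk0 : (0 < p ^ k)%N by rewrite expn_gt0 prime_gt0.
      have sk : (absz (s %% (p ^ k)%:Z)%Z < (p ^ k).-1.+1)%N.
        rewrite prednK // -ltz_nat gez0_abs ?modz_ge0 ?ltz_pmod //.
        by rewrite -lt0n.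
      exists (Ordinal sk) => _ /=.
      rewrite pmulrn gez0_abs ?modz_ge0 -?lt0n // es.
      rewrite {1}(divz_eq s (p ^ k)%:Z) mulrzDr mulrC mulrzA -pmulrn eik.
      by rewrite mul0rz add0r.
    (* The shift by [i.+1] keeps the indices above [i], where [r] is not the dummy [ord0]. *)
    have [j1 [j2 [j12 rj]]] := almost_full_finite (fun j => r (i.+1 + j)%N).
    apply: (@eN (i.+1 + j1)%N (i.+1 + j2)%N); first by rewrite ltn_add2l.
    by rewrite (rP _ (ltn_addr j1 (ltnSn i))) (rP _ (ltn_addr j2 (ltnSn i))) rj.
  exists j => //.
  have [eij _] := Qg _ _ ij.
  have [//|[r er]] := p_elt_cyclic pp (pe i) (pe j) eij.
  exists r => //; apply: contrapT => /negP pr; apply: nej.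
  by rewrite er; exact: p_elt_gen pp (pe j) pr.
have [i ei0] : exists i, e i != 0.
  have [e0|] := eqVneq (e 0%N) 0; last by exists 0%N.
  by exists 1%N; apply/eqP => e1; apply: (@eN 0%N 1%N); rewrite ?e0 ?e1.
(* Two steps up the chain: [e i != 0] forces [e j *+ p != 0], which the comparison of [e j] with
   [e k] requires. *)
have [j _ [r /dvdzP[r' rr'] er]] := climb i.
have [k jk [s ps es]] := climb j.
have [_ [ajk bjk]] := Qg _ _ jk.
have jp0 : e j *+ p != 0.
  apply: contraNneq ei0 => jp.
  by rewrite er rr' mulrC mulrzA -pmulrn jp mul0rz.
apply: nab; exists (e k).
  exact: shifted_socle_multiple es ps ap jp0 ajk.
exact: shifted_socle_multiple es ps bp jp0 bjk.
Qed.

(** The [p]-parts of the terms cannot all be distinct, and when two of them agree they cancel in the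
    difference. *)
Lemma almost_full_p_part p : almost_full cyclic_pair -> torsion -> prime p ->
  ~ p_cyclic p ->
  almost_full (fun x y => exists2 m, ~~ (p %| m)%N & (y - x) *+ m = 0).
Proof.
move=> afc tor pp npc f.
have /choice[g gP] : forall i, exists g, p_elt p g /\
    exists2 m, ~~ (p %| m)%N & (f i - g) *+ m = 0.
  move=> i; have [n n0 fn] := tor (f i).
  have [g [h [-> pg _ _ hn]]] := p_part_split pp n0 fn.
  exists g; split=> //; exists (n`_p^')%N; first exact: p_part_coprime.
  by rewrite addrAC subrr add0r.
have [i [j [ij gij]]] :=
  almost_full_p_elt afc pp npc (fun i => proj1 (gP i)).
exists i, j; split=> //.
have [_ [m pm fm]] := gP i; have [_ [n pn fn]] := gP j.
exists (m * n)%N; first by rewrite Euclid_dvdM // negb_or pm.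
have -> : f j - f i = (f j - g j) - (f i - g i).
  by rewrite gij opprB addrA subrK.
by rewrite mulrnBl {1}mulnC !mulrnA fm fn !mul0rn subrr.
Qed.

Lemma prime_dvd_prod (I : Type) (s : seq I) (P : pred I) (F : I -> nat) p :
  prime p -> (forall i, P i -> ~~ (p %| F i)%N) ->
  ~~ (p %| \prod_(i <- s | P i) F i)%N.
Proof.
move=> pp PF; elim/big_ind: _ => // [|m n pm pn].
  by rewrite dvdn1; apply: contraTneq pp => ->.
by rewrite Euclid_dvdM // negb_or pm.
Qed.

(* If a_i, b_i are independent of prime order e_i for distinct e_i, then suitable
   multiples of b_n + a_0 + ... + a_(n-1) and of a later such element give back
   b_n and a_n. *)
Lemma finite_noncyclic_primes : almost_full cyclic_pair ->
  exists s : seq nat, forall p, prime p -> ~ p_cyclic p -> p \in s.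
Proof.
move=> afc; pose bad p := prime p /\ ~ p_cyclic p.
(* A covering list for this relation contains every bad prime. A sequence without a related pair
   consists, from its second term on, of distinct bad primes. *)
suff /almost_full_cover[s sP] : almost_full (fun p q : nat => bad q -> p = q).
  by exists s => p pp pc; have [q qs <-] := sP p.
move=> f; apply: contrapT => nf.
pose e i := f i.+1.
have eN i j : (i < j)%N -> e i <> e j.
  by move=> ij eij; apply: nf; exists i.+1, j.+1.
have eb i : bad (e i).
  by apply: contrapT => nb; apply: nf; exists i, i.+1.
have /choice[a /choice[b abP]] : forall i, exists a b : V,
    [/\ a *+ e i = 0, b *+ e i = 0 & ~ cyclic_pair b a].
  move=> i; have [_ /existsNP[b /existsNP[a]]] := eb i.
  by move=> /not_implyP[bp] /not_implyP[ap ?]; exists a, b.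
have pe i : prime (e i) by have [] := eb i.
have eNdvd i j : i != j -> ~~ (e i %| e j)%N.
  move=> ij; rewrite dvdn_prime2 //; apply/eqP => eij; move: ij.
  by rewrite neq_ltn => /orP[] /eN; rewrite eij.
have [n [m [nm wnm]]] := afc (fun n => b n + \sum_(i < n) a i).
have [an bn nab] := abP n; apply: nab.
(* [M] kills [b m] and every [a i] with [i <= m] except [a n]; [N] kills every [a i] with [i < n].
   Both are prime to [e n], so [a n] and [b n] can be recovered from these multiples. *)
pose M := (\prod_(i < m.+1 | val i != n) e i)%N.
pose N := (\prod_(i < n) e i)%N.
have kill c k K : c *+ k = 0 -> (k %| K)%N -> c *+ K = 0.
  by move=> ck /dvdnP[q ->]; rewrite mulnC mulrnA ck mul0rn.
have pelt c : c *+ e n = 0 -> p_elt (e n) c by exists 1%N; rewrite expn1.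
have dM i : (i < m.+1)%N -> i != n -> (e i %| M)%N.
  move=> im iN; rewrite /M (bigD1 (Ordinal im)) //=.
  exact: dvdn_mulr.
apply: cyclic_pair_multiple wnm.
  apply: multiple_trans (p_elt_gen (i := N%:Z) (pe n) (pelt _ bn) _).
    rewrite -pmulrn.
    have -> : b n *+ N = (b n + \sum_(i < n) a i) *+ N.
      rewrite mulrnDl -sumrMnl [X in _ = _ + X]big1 ?addr0 // => i _.
      have [ai _ _] := abP i; apply: kill ai _.
      by rewrite /N (bigD1 i) //= dvdn_mulr.
    by exists N%:Z.
  rewrite dvdzE /=; apply: prime_dvd_prod => // i _; apply: eNdvd.
  by rewrite gtn_eqF.
apply: multiple_trans (p_elt_gen (i := M%:Z) (pe n) (pelt _ an) _).
  rewrite -pmulrn.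
  have -> : a n *+ M = (b m + \sum_(i < m) a i) *+ M.
    have [_ bm _] := abP m.
    rewrite mulrnDl (kill _ _ _ bm); last by rewrite dM // gtn_eqF.
    rewrite add0r -sumrMnl (bigD1 (Ordinal nm)) //= big1 ?addr0 // => i iN.
    have [ai _ _] := abP i; apply: kill ai _.
    by rewrite dM // ltnW // ltnS.
  by exists M%:Z.
rewrite dvdzE /=; apply: prime_dvd_prod => // i iN; apply: eNdvd.
by rewrite eq_sym.
Qed.

(** In the torsion case the finitely many bad primes are treated simultaneously, which yields a
    difference of order prime to all of them. *)
Lemma almost_full_cyc_center : almost_full cyclic_pair ->
  almost_full (fun x y => cyc_center (y - x)).
Proof.
move=> afc; have [tor|tf] := torsion_dichotomy afc; last first.
  by move=> f; exists 0%N, 1%N; split=> // z; exact: torsion_free_cyclic.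
have [s sP] := finite_noncyclic_primes afc.
have /almost_full_sub : almost_full (fun x y => forall p, p \in s ->
    prime p -> ~ p_cyclic p -> exists2 m, ~~ (p %| m)%N & (y - x) *+ m = 0).
  apply: almost_full_all => p _.
  have [pp|pp] := pselect (prime p); last by move=> f; exists 0%N, 1%N.
  have [pc|pc] := pselect (p_cyclic p); first by move=> f; exists 0%N, 1%N.
  exact: almost_full_sub (almost_full_p_part afc tor pp pc).
apply=> x y xy; have [n n0 yxn] := tor (y - x).
have [k k0 kP] := torsion_order n0 yxn.
apply: (@coprime_cyc_center k) => //; last by apply/eqP; rewrite kP.
move=> p pp pk; apply: contrapT => pc.
have [m pm /eqP] := xy p (sP p pp pc) pp pc.
by rewrite kP => /(dvdn_trans pk); apply/negP.
Qed.

End Zmodule.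

(** * Groups without infinite cliques *)

Section Powers.
Variable G : groupType.
Implicit Types (x y w z : G) (H : set G).
Local Open Scope group_scope.

(** * Subgroups and integer powers *)

Lemma is_subgroupP H :
  is_subgroup H <-> H 1 /\ (forall x y, H x -> H y -> H (x / y)).
Proof.
split=> [[H1 HF]|[H1 HF]].
  split=> [|x y Hx Hy]; first by apply/set_mem: H1.
  by apply: set_mem; apply: (HF x y); exact: mem_set.
split=> [|x y Hx Hy]; first exact: mem_set.
by apply: mem_set; apply: HF; exact: set_mem.
Qed.

Lemma subgroup_invM H : is_subgroup H ->
  (forall x, H x -> H x^-1) /\ (forall x y, H x -> H y -> H (x * y)).
Proof.
move=> /is_subgroupP[H1 HF].
have HV x : H x -> H x^-1 by move=> /(HF 1 x H1); rewrite mul1g.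
by split=> // x y Hx /HV Hy; rewrite -[y]invgK; exact: HF.
Qed.

Lemma generated_subgroup (X : set G) : is_subgroup (generated X).
Proof.
apply/is_subgroupP; split=> [H [/is_subgroupP[]]//|x y Xx Xy H HX].
have [/is_subgroupP[_ HF] _] := HX.
by apply: HF; [exact: Xx | exact: Xy].
Qed.

Lemma generated_sub (X H : set G) :
  is_subgroup H -> (X `<=` H)%classic -> (generated X `<=` H)%classic.
Proof. exact: smallest_sub. Qed.

Definition expgz x (i : int) : G :=
  match i with Posz n => x ^+ n | Negz n => x ^- n.+1 end.

Lemma expgz_sub x m n : expgz x (m%:Z - n%:Z)%R = x ^+ m / x ^+ n.
Proof.
have [nm|mn] := leqP n m; first by rewrite subzn //= expgnFr.
have -> : (m%:Z - n%:Z)%R = Negz (n - m).-1 by lia.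
by rewrite /= prednK ?subn_gt0 // expgnFr 1?ltnW // invgF.
Qed.

Lemma int_sub_nat (i : int) : exists m n : nat, i = (m%:Z - n%:Z)%R.
Proof. by case: i => n; [exists n, 0|exists 0, n.+1]; lia. Qed.

(** Writing the exponents as differences of natural numbers avoids a case analysis on signs. *)
Lemma expgzB x (i j : int) : expgz x (i - j)%R = expgz x i / expgz x j.
Proof.
have [m [n ->]] := int_sub_nat i; have [p [q ->]] := int_sub_nat j.
have -> : (m%:Z - n%:Z - (p%:Z - q%:Z) = (m + q)%:Z - (n + p)%:Z)%R by lia.
have cx k : commute (x ^+ k) x^-1.
  by apply/commuteV/commute_sym/commuteX.
rewrite !expgz_sub !expgnDr !invgM !invgK -!mulgA; congr (_ * _).
rewrite !mulgA -[RHS]mulgA -!expVgn.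
apply/commute_sym/commuteM; last exact: commuteX2.
by apply/commute_sym/commuteX.
Qed.

Lemma expgzN x (i : int) : expgz x (- i)%R = (expgz x i)^-1.
Proof. by rewrite -sub0r expgzB mul1g. Qed.

Lemma expgzD x (i j : int) : expgz x (i + j)%R = expgz x i * expgz x j.
Proof. by rewrite -[j]opprK expgzB !expgzN !invgK. Qed.

Lemma expgz_expn x (i : int) n : expgz x (i * n%:Z)%R = expgz x i ^+ n.
Proof.
elim: n => [|n IH]; first by rewrite mulr0.
by rewrite expgSr -IH -expgzD; congr expgz; lia.
Qed.

Lemma expgzM x (i j : int) : expgz x (i * j)%R = expgz (expgz x i) j.
Proof.
have [m [n ->]] := int_sub_nat j.
by rewrite mulrBr !expgzB !expgz_expn.
Qed.

Lemma expgz_subgroup H x (i : int) : is_subgroup H -> H x -> H (expgz x i).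
Proof.
move=> sH Hx; have [HV HM] := subgroup_invM sH.
have /is_subgroupP[H1 _] := sH.
have Hn n : H (x ^+ n) by elim: n => // n IH; rewrite expgS; exact: HM.
by case: i => n /=; [|apply: HV].
Qed.

Lemma generated_set1 w : generated [set w]%classic = range (expgz w).
Proof.
apply/seteqP; split.
  apply: generated_sub => [|_ ->]; last by exists 1%R.
  apply/is_subgroupP; split; first by exists 0%R.
  by move=> _ _ [i _ <-] [j _ <-]; exists (i - j)%R; rewrite ?expgzB.
move=> _ [i _ <-].
have gw : generated [set w]%classic w by exact: sub_gen_smallest.
exact: (expgz_subgroup i (generated_subgroup _) gw).
Qed.

(** * Pairs generating a cyclic subgroup, and cosets of [Cyc G] *)

Definition cyclic2 x y : Prop := cyclic (generated [set x; y]%classic).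

(** Recording that [w] lies in [<x, y>] keeps it inside any subgroup that contains [x] and [y]. *)
Lemma cyclic2P x y : cyclic2 x y -> exists2 w, generated [set x; y]%classic w &
  (exists i, x = expgz w i) /\ (exists j, y = expgz w j).
Proof.
move=> [w]; rewrite generated_set1 => gw; exists w.
  by rewrite gw; exists 1%R.
have [] : range (expgz w) x /\ range (expgz w) y.
  by rewrite -gw; split; apply: sub_gen_smallest; [left|right].
by move=> [i _ ix] [j _ jy]; split; [exists i|exists j].
Qed.

(** By Bezout, the power of [w] with exponent [gcdz i j] is a generator. *)
Lemma expgz_cyclic2 w (i j : int) : cyclic2 (expgz w i) (expgz w j).
Proof.
exists (expgz w (gcdz i j)); apply/seteqP; split; apply: generated_sub;
  try exact: generated_subgroup; rewrite ?generated_set1.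
  move=> x [->|->].
    by exists (i %/ gcdz i j)%Z => //; rewrite -expgzM mulrC divzK ?dvdz_gcdl.
  by exists (j %/ gcdz i j)%Z => //; rewrite -expgzM mulrC divzK ?dvdz_gcdr.
move=> _ ->; have [u [v <-]] := Bezoutz i j.
have sG := generated_subgroup [set expgz w i; expgz w j]%classic.
have [_ HM] := subgroup_invM sG.
rewrite mulrC [(v * j)%R]mulrC expgzD !expgzM.
by apply: (HM); apply: (expgz_subgroup _ sG); apply: sub_gen_smallest;
  [left|right].
Qed.

Lemma cyclic2_refl x : cyclic2 x x.
Proof. exact: (expgz_cyclic2 x 1 1). Qed.

Lemma cyclic2C x y : cyclic2 x y -> cyclic2 y x.
Proof. by rewrite /cyclic2 setUC. Qed.

Lemma cyclic2_commute x y : cyclic2 x y -> commute x y.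
Proof.
move=> /cyclic2P[w _ [[i ->] [j ->]]].
by rewrite /commute -!expgzD addrC.
Qed.

Lemma Cyc1 : Cyc G 1.
Proof. by move=> y; exact: (expgz_cyclic2 y 0 1). Qed.

Lemma CycV x : Cyc G x -> Cyc G x^-1.
Proof.
move=> cx y; have [w _ [[i ->] [j ->]]] := cyclic2P (cx y).
by rewrite -expgzN; exact: expgz_cyclic2.
Qed.

(** If [w] generates [<y, z>] and [t] generates [<x, w>], then [x * y] and [z] are powers of [t]. *)
Lemma CycM x y : Cyc G x -> Cyc G y -> Cyc G (x * y).
Proof.
move=> cx cy z; have [w _ [[i yw] [j zw]]] := cyclic2P (cy z).
have [t _ [[k ->] [l wt]]] := cyclic2P (cx w).
rewrite yw zw wt -!expgzM -expgzD; exact: expgz_cyclic2.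
Qed.

Lemma left_coset_eqP x y : left_coset (Cyc G) x = left_coset (Cyc G) y <->
  Cyc G (x^-1 * y).
Proof.
have sub a b : Cyc G (a^-1 * b) ->
    (left_coset (Cyc G) b `<=` left_coset (Cyc G) a)%classic.
  move=> cab _ [c cc <-]; exists (a^-1 * b * c); first exact: CycM.
  by rewrite !mulgA mulgV mul1g.
split=> [xy|cxy].
  have : left_coset (Cyc G) y y by exists 1; [exact: Cyc1 | rewrite mulg1].
  by rewrite -xy => -[c cc <-]; rewrite mulKg.
apply/seteqP; split; apply: sub => //.
by rewrite -[y^-1 * x]invgK invgM invgK; exact: CycV.
Qed.

(** * Commutative subgroups as additive groups *)

Lemma subgroup_zmod H : is_subgroup H ->
  (forall x y, H x -> H y -> commute x y) ->
  exists (V : zmodType) (f : V -> G),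
    [/\ forall u v : V, f (u - v)%R = f u / f v, injective f,
        forall u, H (f u) & forall x, H x -> exists u, f u = x].
Proof.
move=> sH cH; have /is_subgroupP[H1 HF] := sH; have [HV HM] := subgroup_invM sH.
pose T := {x : G | x \in H}.
have TI : injective (val : T -> G) by exact: val_inj.
pose t0 : T := exist _ 1 (mem_set H1).
pose opp (u : T) : T := exist _ (val u)^-1 (mem_set (HV _ (set_mem (valP u)))).
pose add (u v : T) : T := exist _ (val u * val v)
  (mem_set (HM _ _ (set_mem (valP u)) (set_mem (valP v)))).
have addA : associative add by move=> u v w; apply: val_inj; rewrite /= mulgA.
have addC : commutative add.
  by move=> u v; apply: val_inj; apply: cH; apply: set_mem; exact: valP.
have add0 : left_id t0 add by move=> u; apply: val_inj; rewrite /= mul1g.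
have addN : left_inverse t0 opp add.
  by move=> u; apply: val_inj; rewrite /= mulVg.
pose V := HB.pack_for zmodType T (GRing.isZmodule.Build T addA addC add0 addN).
exists V, (val : T -> G); split=> [//||u|x Hx].
- exact: (@val_inj _ _ T).
- by apply: set_mem; exact: (valP (u : T)).
- by exists (exist _ x (mem_set Hx)).
Qed.

(** The additive result is applied to [H] seen as a [zmodType]. The hypothesis transfers because a
    generator of [<x, y>], for [x] and [y] in [H], is again in [H]. *)
Lemma abelian_almost_full H : almost_full cyclic2 -> is_subgroup H ->
  (forall x y, H x -> H y -> commute x y) ->
  forall f : nat -> G, (forall i, H (f i)) ->
  exists i j, (i < j)%N /\ forall z, H z -> cyclic2 ((f i)^-1 * f j) z.
Proof.
move=> afc sH cH f Hf.
have [V [h [hB hI Hh hS]]] := subgroup_zmod sH cH.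
have h0 : h 0%R = 1 by rewrite -(subrr 0%R) hB mulgV.
have hN u : h (- u)%R = (h u)^-1 by rewrite -sub0r hB h0 mul1g.
have hD u v : h (u + v)%R = h u * h v by rewrite -{1}[v]opprK hB hN invgK.
have hMn u n : h (u *+ n)%R = h u ^+ n.
  by elim: n => [|n IH]; rewrite ?mulr0n // mulrS expgS hD IH.
have hM u (i : int) : h (u *~ i)%R = expgz (h u) i.
  by case: i => n /=; rewrite ?NegzE ?mulrNz ?hN hMn.
have afV : almost_full (@cyclic_pair V).
  move=> g; have [i [j [ij /cyclic2P[w gw [[k kw] [l lw]]]]]] := afc (h \o g).
  have Hw : H w by apply: generated_sub gw => // _ [->|->] /=.
  have [u uw] := hS w Hw; exists i, j; split=> //.
  by exists u; [exists k|exists l]; apply: hI; rewrite hM uw.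
have /choice[g gP] : forall i, exists u, h u = f i by move=> i; exact: hS.
have [i [j [ij cij]]] := almost_full_cyc_center afV g.
exists i, j; split=> // z /hS[u <-]; have [w [k kw] [l ->]] := cij u.
have -> : (f i)^-1 * f j = expgz (h w) k.
  rewrite -!gP -hM -kw -hN -hD addrC //.
by rewrite hM; exact: expgz_cyclic2.
Qed.

End Powers.

(** * Finite index of the centre and of [Cyc G] *)

Section CenterByFinite.
Variable G : groupType.
Implicit Types (x y z a b t u v w : G) (s : seq G).
Local Open Scope group_scope.

Hypothesis afc : almost_full (@cyclic2 G).

Lemma commuteM_cancel x y z : commute x (y * z) -> commute x y -> commute x z.
Proof.
move=> xyz xy; apply: (mulgI y).
by rewrite !mulgA -xy -!mulgA xyz mulgA.
Qed.

Lemma almost_full_commute : almost_full (@commute G).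
Proof. exact: almost_full_sub (@cyclic2_commute G) afc. Qed.

(* x, y commute and a x, a y commute, so x^-1 y commutes with a. *)
Lemma almost_full_centralizer a : almost_full (fun x y => commute a (x^-1 * y)).
Proof.
have /almost_full_sub : almost_full
    (fun x y => commute x y /\ commute (a * x) (a * y)).
  apply: almost_fullI; first exact: almost_full_commute.
  by move=> f; exact: (almost_full_commute (fun i => a * f i)).
apply=> x y [xy axy].
have xay : x * a * y = y * a * x.
  by apply: (mulgI a); move: axy; rewrite /commute !mulgA.
have yVx : y * x^-1 = x^-1 * y by apply: commuteV; exact: commute_sym.
have : a * y * x^-1 = x^-1 * y * a.
  by apply: (mulgI x); apply: (mulIg x); rewrite !mulgA mulgVK mulgV mul1g.
by rewrite -mulgA yVx.
Qed.

(* In a counterexample of pairs (u_i, v_i), the elements v_n u_0 ... u_(n-1) would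
   be pairwise non-commuting: v_n commutes with everything but u_n. *)
Lemma almost_full_abelian_tail : almost_full (fun p q : G * G =>
  commute p.1 q.1 -> commute p.1 q.2 -> commute p.2 q.1 -> commute p.2 q.2 ->
  commute q.1 q.2).
Proof.
move=> f; apply: contrapT => nf.
(* The pair of index 0 is set aside, so that each [(u i, v i)] has a predecessor and therefore does
   not commute. *)
pose u i := (f i.+1).1; pose v i := (f i.+1).2.
have lt_all i j : (i < j)%N ->
    [/\ commute (u i) (u j), commute (u i) (v j), commute (v i) (u j),
        commute (v i) (v j) & ~ commute (u j) (v j)].
  move=> ij; apply: contrapT => H; apply: nf; exists i.+1, j.+1; split=> //.
  by move=> uu uv vu vv; apply: contrapT => nuv; apply: H.
have nuv i : ~ commute (v i) (u i).
  move=> /commute_sym uv; apply: nf; exists 0%N, i.+1; split=> //.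
have cuu i j : commute (u i) (u j).
  by case: (ltngtP i j) => [/lt_all[]|/lt_all[/commute_sym]|->].
have cvu i j : i != j -> commute (v i) (u j).
  by case: (ltngtP i j) => [/lt_all[]|/lt_all[_ /commute_sym]|].
pose q := fix q n := if n is m.+1 then q m * u m else 1.
have cq x n : (forall i, (i < n)%N -> commute x (u i)) -> commute x (q n).
  elim: n => [|n IH] cx; first exact: commute1.
  by apply: commuteM; [apply: IH => i /ltnW; exact: cx | exact: cx].
have [n [m [nm wnm]]] := almost_full_commute (fun n => v n * q n).
have cwu i : (n < i)%N -> commute (v n * q n) (u i).
  move=> ni; apply/commute_sym/commuteM; last by apply: cq.
  by apply/commute_sym/cvu; rewrite ltn_eqF.
have cvq k l : (k <= l)%N -> commute (v l) (q k).
  by move=> kl; apply: cq => i ik; apply: cvu; rewrite gtn_eqF // (leq_trans ik).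
have wv : commute (v n * q n) (v m).
  apply/commute_sym/commuteM; first by apply/commute_sym; case: (lt_all _ _ nm).
  by apply: cvq; exact: ltnW.
have wq : commute (v n * q n) (q m) by exact: commuteM_cancel wnm wv.
(* [q m] is [q n * u n] followed by the [u i] with [n < i < m]; these are cancelled from the right,
   and [q n] from the left. *)
have wun : commute (v n * q n) (u n).
  have qq : commute (v n * q n) (q n).
    by apply/commute_sym/commuteM; first exact/commute_sym/cvq.
  elim: m nm wq {wnm wv} => // m IH; rewrite ltnS leq_eqVlt => /predU1P[<-|nm].
    by move=> wq; exact: commuteM_cancel wq qq.
  move=> wq; apply: IH => //; have := commuteV wq.
  rewrite /= invgM => /commuteM_cancel wqV.
  by rewrite -[q m]invgK; apply/commuteV/wqV/commuteV/cwu.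
apply: (nuv n); apply: commute_sym.
have qun : commute (u n) (q n) by apply: cq.
have -> : v n = v n * q n * (q n)^-1 by rewrite mulgK.
by apply: commuteM; [exact: commute_sym | exact: commuteV].
Qed.

(** Any two elements that commute with the finite list [s'] commute with each other. So the
    centralizer of [s'] is abelian, and it has finite index, with coset representatives [t]. An
    element commuting with [s'] and [t] is then central. *)
Lemma almost_full_center :
  almost_full (fun x y => forall z, commute z (x^-1 * y)).
Proof.
have [s sP] := almost_full_cover almost_full_abelian_tail.
pose s' := [seq p.1 | p <- s] ++ [seq p.2 | p <- s].
have abel u v : (forall a, a \in s' -> commute a u) ->
    (forall a, a \in s' -> commute a v) -> commute u v.
  move=> su sv; have [p ps] := sP (u, v).
  have p1 : p.1 \in s' by rewrite mem_cat map_f.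
  have p2 : p.2 \in s' by rewrite mem_cat map_f ?orbT.
  by apply; [exact: su|exact: sv|exact: su|exact: sv].
have [t tP] := almost_full_cover
  (almost_full_all (s := s') (fun a _ => almost_full_centralizer a)).
have /almost_full_sub := almost_full_all (s := s' ++ t)
  (fun a _ => almost_full_centralizer a).
apply=> x y xy z; have [c ct zc] := tP z.
rewrite -[z](mulVKg c); apply/commute_sym/commuteM; apply: commute_sym.
  by apply: xy; rewrite mem_cat ct orbT.
by apply: abel => // a sa; apply: xy; rewrite mem_cat sa.
Qed.

(** This is [C(C(t))]: it is commutative because [t] lies in [C(t)], and it contains the coset of
    the centre through [t]. *)
Definition bicentralizer t : set G :=
  [set x | forall a, commute t a -> commute a x]%classic.

Lemma bicentralizer_subgroup t : is_subgroup (bicentralizer t).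
Proof.
apply/is_subgroupP; split=> [a _|x y Hx Hy a ta]; first exact: commute1.
by apply: commuteM; [exact: (Hx a ta) | exact/commuteV/(Hy a ta)].
Qed.

Lemma bicentralizer_commute t x y :
  bicentralizer t x -> bicentralizer t y -> commute x y.
Proof. by move=> Hx Hy; exact: (Hy x (Hx t (commute_refl t))). Qed.

(** For [t] running over representatives modulo the centre, the subgroups [bicentralizer t] cover
    [G]. Along a subsequence the elements [(f (g 0))^-1 * f (g i)] are central, hence lie in all of
    these subgroups, and the finitely many abelian results can be intersected. *)
Lemma almost_full_Cyc : almost_full (fun x y => Cyc G (x^-1 * y)).
Proof.
have [s sP] := almost_full_cover almost_full_center.
move=> f; have [g gm gZ] := almost_full_ramsey f almost_full_center.
have af_H : almost_full (fun x y => forall t, t \in s ->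
    bicentralizer t x -> bicentralizer t y ->
    forall z, bicentralizer t z -> cyclic2 (x^-1 * y) z).
  apply: almost_full_all => t _ h.
  have [Hh|/existsNP[i nHi]] := pselect (forall i, bicentralizer t (h i));
    last first.
    by exists i, i.+1.
  have [i [j [ij cij]]] := abelian_almost_full afc
    (bicentralizer_subgroup t) (@bicentralizer_commute t) Hh.
  by exists i, j.
have [i [j [ij cij]]] := af_H (fun i => (f (g 0%N))^-1 * f (g i.+1)).
exists (g i.+1), (g j.+1); split; first exact: gm.
have HZ t k : bicentralizer t ((f (g 0%N))^-1 * f (g k.+1)).
  by move=> a _; exact: gZ.
move=> z; have [t ts tz] := sP z.
have -> : (f (g i.+1))^-1 * f (g j.+1) =
    ((f (g 0%N))^-1 * f (g i.+1))^-1 * ((f (g 0%N))^-1 * f (g j.+1)).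
  by rewrite invgM invgK -!mulgA mulVKg.
apply: cij ts _ _ _ _; try exact: HZ.
move=> a ta; rewrite -[z](mulVKg t); apply: commuteM; last exact: tz.
exact: commute_sym.
Qed.

End CenterByFinite.

(** * The non-cyclic graph *)

Section NonCyclicGraphCliques.
Local Open Scope classical_set_scope.
Local Open Scope card_scope.
Variable G : groupType.

(** A sequence without a cyclic pair enumerates an infinite clique: its terms are distinct since
    [<x, x>] is cyclic, and each lies outside [Cyc G] because of its successor. *)
Lemma no_infinite_clique_almost_full :
  no_infinite_clique (noncyclic_graph G) -> almost_full (@cyclic2 G).
Proof.
move=> noK f; apply: contrapT => nf.
have ncyc i j : (i < j)%N -> ~ cyclic2 (f i) (f j).
  by move=> ij cij; apply: nf; exists i, j.
have fK i : ~ Cyc G (f i) by move=> /(_ (f i.+1)); exact: ncyc.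
pose e i : {x | ~ Cyc G x} := exist _ (f i) (fK i).
have adjE i j : i <> j -> noncyclic_adj (e i) (e j).
  move=> ij; have nc : ~ cyclic2 (f i) (f j).
    case: (ltngtP i j) ij => [/ncyc //|/ncyc nji _ /cyclic2C//|//].
  split=> // eij; apply: nc; have -> : f i = f j := congr1 sval eij.
  exact: cyclic2_refl.
apply: noK; exists (range e); split.
  by move=> _ _ [i _ <-] [j _ <-] eij; apply: adjE => ij; apply: eij; rewrite ij.
have eI : {in [set: nat] &, injective e}.
  by move=> i j _ _ eij; apply: contrapT => /adjE; rewrite eij => -[].
by apply/infiniteP; have := inj_card_eq eI; rewrite card_eq_le => /andP[].
Qed.

(** Cosets separate the vertices of a clique: if [y = x * c] with [c] in [Cyc G], then [x] and [y]
    lie in the cyclic group [<c, x>]. *)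
Lemma clique_card_le (K : set (noncyclic_graph G)) :
  clique K -> K #<= quotient (Cyc G).
Proof.
move=> cK; pose q (x : noncyclic_graph G) := left_coset (Cyc G) (sval x).
have qI : {in K &, injective q}.
  move=> x y /set_mem Kx /set_mem Ky /left_coset_eqP cxy.
  apply: contrapT => /(cK x y Kx Ky)[_]; apply.
  have [w _ [[i xyw] [j xw]]] := cyclic2P (cxy (sval x)).
  have -> : sval y = expgz w (j + i)%R by rewrite expgzD -xyw -xw mulVKg.
  by rewrite xw; exact: expgz_cyclic2.
have := inj_card_eq qI; rewrite card_eq_le => /andP[_ /card_le_trans]; apply.
by apply: subset_card_le => _ [x _ <-]; exists (sval x).
Qed.

Lemma almost_full_finite_quotient :
  almost_full (fun x y => Cyc G (x^-1 * y)%g) -> finite_set (quotient (Cyc G)).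
Proof.
move=> /almost_full_cover[s sP].
apply: (@sub_finite_set _ _ (left_coset (Cyc G) @` [set` s])).
  move=> _ [x _ <-]; have [y ys yx] := sP x.
  by exists y => //; exact/left_coset_eqP.
exact/finite_image/finite_seq.
Qed.

Lemma finite_quotient_no_infinite_clique :
  finite_set (quotient (Cyc G)) -> no_infinite_clique (noncyclic_graph G).
Proof.
by move=> finQ [K [/clique_card_le/card_le_finite/(_ finQ)]].
Qed.

(** Every clique is finite with size at most the order [N] of the quotient, and the empty clique
    shows that some size occurs, so a largest size exists. *)
Lemma finite_quotient_clique_number : finite_set (quotient (Cyc G)) ->
  exists n, is_clique_number (noncyclic_graph G) n.
Proof.
move=> finQ; have /finite_setP[N QN] := finQ.
pose P n := `[< exists K : set (noncyclic_graph G), clique K /\ K #= `I_n >].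
have P0 : exists n, P n.
  by exists 0%N; apply/asboolP; exists set0; split=> //; rewrite II0.
have Pmax n : P n -> (n <= N)%N.
  move=> /asboolP[K [/clique_card_le KQ Kn]].
  by move: KQ; rewrite (card_le_eql Kn) (card_le_eqr QN) card_le_II.
have [n /asboolP Pn nmax] := ex_maxnP P0 Pmax; exists n; split=> // K cK.
have /finite_setP[k Kk] := card_le_finite (clique_card_le cK) finQ.
rewrite (card_le_eql Kk) card_le_II; apply: nmax; apply/asboolP.
by exists K.
Qed.

End NonCyclicGraphCliques.

Theorem theorem4p2 (G : groupType) :
  ~ locally_cyclic G ->
  (no_infinite_clique (noncyclic_graph G) <-> finite_set (quotient (Cyc G))) /\
  (no_infinite_clique (noncyclic_graph G) ->
     exists n : nat, is_clique_number (noncyclic_graph G) n).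
Proof.
move=> _; have finQ : no_infinite_clique (noncyclic_graph G) ->
    finite_set (quotient (Cyc G)).
  by move=> /no_infinite_clique_almost_full/almost_full_Cyc;
    exact: almost_full_finite_quotient.
split; last by move=> /finQ; exact: finite_quotient_clique_number.
by split=> //; exact: finite_quotient_no_infinite_clique.
Qed.
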